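(* Let $\Omega=\Omega(u,v)$ be a solution in $E^4$ of the Betchov-Da Rios equation $\Omega_v=\Omega_u\times\Omega_{uu}\times\Omega_{uuu}$ whose $u$-parameter curves are unit speed, with ED$^2$-frame field $\{T,E,D,N\}$ and associated functions $\kappa,\sigma,\tau$ (notation and standing assumptions as in the context). The soliton surface $S:\Omega=\Omega(u,v)$ is flat (its Gaussian curvature vanishes identically) if and only if $a_{34}=\kappa\tau\sigma^2$ holds, where $$a_{34}=\frac1\kappa\Big(\big(\kappa\tau\sigma^2-4\kappa_u\tau_u-\kappa\tau_{uu}\big)\kappa-2\big(\kappa_u^2+\kappa\kappa_{uu}\big)\tau\Big).$$
   Context: $E^4$ is Euclidean 4-space with inner product $\langle\cdot,\cdot\rangle$, and $x\times y\times z$ is the usual alternating ternary vector product of $E^4$ (with a fixed sign convention, e.g. $\langle w,x\times y\times z\rangle=\det(w,x,y,z)$). Subscripts $u,v$ denote partial derivatives. All functions are assumed sufficiently smooth on an open domain of the $(u,v)$-plane. ED$^2$-frame field: for each $v$, the unit speed curve $u\mapsto\Omega(u,v)$ lies on an oriented hypersurface of $E^4$; $T=\Omega_u$ and $N(u,v)$ is the unit normal of the hypersurface at $\Omega(u,v)$. One is in the case where $\{N,T,\Omega_{uu}\}$ is linearly dependent; $E$ is the normalization of $\Omega_{uuu}-\langle\Omega_{uuu},N\rangle N-\langle\Omega_{uuu},T\rangle T$ (assumed nonzero), and $D=N\times T\times E$. Associated functions: $\kappa=\kappa_n=\langle T_u,N\rangle$, $\sigma=\kappa_g^2=\langle E_u,D\rangle$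 (the superscript in $\kappa_g^2$ is an index, not a power), $\tau=\tau_g^1=\langle E_u,N\rangle$. The frame satisfies $T_u=\kappa N$, $E_u=\sigma D+\tau N$, $D_u=-\sigma E$, $N_u=-\kappa T-\tau E$. Standing assumption: $\kappa$ and $\tau$ are nowhere zero. *)

(* Defs.v *)
(* Points of the parameter plane are pairs (u, v) : R * R; vectors of E^4 are
   row vectors 'rV[R]_4. *)
From HB Require Import structures.
From mathcomp Require Import all_boot all_order all_algebra.
From mathcomp Require Import all_classical all_reals all_analysis.

Set Implicit Arguments.
Unset Strict Implicit.
Unset Printing Implicit Defensive.

Import Order.TTheory GRing.Theory Num.Theory.
Import numFieldNormedType.Exports.

Local Open Scope classical_set_scope.
Local Open Scope ring_scope.

Section Euclidean4.
Variable R : realType.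
Implicit Types w x y z : 'rV[R]_4.

Definition dot x y : R := \sum_(i < 4) x 0 i * y 0 i.

(* The norm `|x| that the library puts on 'rV[R]_4 is the sup norm. *)
Definition enorm x : R := Num.sqrt (dot x x).

Definition det4 w x y z : R :=
  \det (col_mx w (col_mx x (col_mx y z)) : 'M[R]_4).

(* The vector determined by dot w (cross3 x y z) = det4 w x y z for all w. *)
Definition cross3 x y z : 'rV[R]_4 := \row_i det4 (delta_mx 0 i) x y z.

Lemma dot_cross3 w x y z : dot w (cross3 x y z) = det4 w x y z.
Proof.
have row0E (a : 'rV[R]_4) (b : 'M[R]_(3, 4)) j :
    (col_mx a b : 'M[R]_4) ord0 j = a 0 j.
  have -> : ord0 = lshift 3 (ord0 : 'I_1) :> 'I_4 by apply: val_inj.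
  exact: (@col_mxEu _ 1 3).
have row1E (a : 'rV[R]_4) (b : 'M[R]_(3, 4)) (k : 'I_3) j :
    (col_mx a b : 'M[R]_4) (lift ord0 k) j = b k j.
  have -> : lift ord0 k = rshift 1 k :> 'I_4 by apply: val_inj.
  exact: (@col_mxEd _ 1 3).
have cof (a a' : 'rV[R]_4) (b : 'M[R]_(3, 4)) j :
    cofactor (col_mx a b : 'M[R]_4) ord0 j =
    cofactor (col_mx a' b : 'M[R]_4) ord0 j.
  rewrite /cofactor; congr (_ * \det _); apply/matrixP => k l.
  by rewrite 2!mxE [RHS]mxE [RHS]mxE !row1E.
rewrite /dot /det4 [RHS](expand_det_row _ ord0); apply: eq_bigr => i _.
rewrite mxE /det4 row0E; congr (_ * _).
rewrite [LHS](expand_det_row _ ord0) (bigD1 i) //= row0E mxE !eqxx mul1r.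
rewrite big1 ?addr0 => [|j /negPf ji]; first exact: cof.
by rewrite row0E mxE ji andbF mul0r.
Qed.

(* M is an embedded C^1 hypersurface, locally the regular zero set of a real
   function F, so that its tangent space at p is the kernel of 'd F p;
   nu is a continuous unit normal field on M, that is, an orientation. *)
Definition oriented_hypersurface (M : set 'rV[R]_4)
    (nu : 'rV[R]_4 -> 'rV[R]_4) : Prop :=
  [/\ forall p, M p -> exists (W : set 'rV[R]_4) (F : 'rV[R]_4 -> R),
        [/\ open W /\ W p,
            forall x, W x -> differentiable F x /\
              forall w, {for x, continuous (fun y => 'd F y w)},
            forall x, W x -> exists w, 'd F x w != 0,
            forall x, W x -> (M x <-> F x = 0)
          & forall w, 'd F p w = 0 -> dot (nu p) w = 0],
      forall p, M p -> enorm (nu p) = 1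
    & {within M, continuous nu}].

End Euclidean4.

Section PartialDerivatives.
Variables (R : realType) (V : normedModType R).
Implicit Types f : R * R -> V.

Definition du f : R * R -> V := 'D_((1, 0) : R * R) f.
Definition dv f : R * R -> V := 'D_((0, 1) : R * R) f.

Fixpoint classC (k : nat) (U : set (R * R)) f : Prop :=
  (forall p, U p -> {for p, continuous f}) /\
  match k with
  | 0 => True
  | k'.+1 =>
      [/\ forall p, U p -> derivable f p ((1, 0) : R * R),
          forall p, U p -> derivable f p ((0, 1) : R * R),
          classC k' U (du f) & classC k' U (dv f)]
  end.

End PartialDerivatives.

Section Surface.
Variables (R : realType) (Om : R * R -> 'rV[R]_4).
Implicit Types (p : R * R) (x : 'rV[R]_4).

Definition fff_E p : R := dot (du Om p) (du Om p).
Definition fff_F p : R := dot (du Om p) (dv Om p).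
Definition fff_G p : R := dot (dv Om p) (dv Om p).
Definition fff_det p : R := fff_E p * fff_G p - fff_F p ^+ 2.

(* x minus its orthogonal projection on the tangent plane, which is spanned by
   the not necessarily orthogonal vectors Om_u and Om_v. *)
Definition normal_part p x : 'rV[R]_4 :=
  x - ((fff_G p * dot x (du Om p) - fff_F p * dot x (dv Om p)) / fff_det p)
        *: du Om p
    - ((fff_E p * dot x (dv Om p) - fff_F p * dot x (du Om p)) / fff_det p)
        *: dv Om p.

(* Vector-valued second fundamental form on the coordinate fields. *)
Definition sff_uu p := normal_part p (du (du Om) p).
Definition sff_uv p := normal_part p (dv (du Om) p).
Definition sff_vv p := normal_part p (dv (dv Om) p).

Definition gaussian_curvature p : R :=
  (dot (sff_uu p) (sff_vv p) - dot (sff_uv p) (sff_uv p)) / fff_det p.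

Definition flat_on (U : set (R * R)) : Prop :=
  forall p, U p -> gaussian_curvature p = 0.

Definition betchov_da_rios (U : set (R * R)) : Prop :=
  forall p, U p ->
    dv Om p = cross3 (du Om p) (du (du Om) p) (du (du (du Om)) p).

End Surface.

Section ED2Frame.
Variables (R : realType) (Om N : R * R -> 'rV[R]_4).
Implicit Type p : R * R.

Definition frT : R * R -> 'rV[R]_4 := du Om.

Definition preE p : 'rV[R]_4 :=
  let w := du (du (du Om)) p in w - dot w (N p) *: N p - dot w (frT p) *: frT p.

Definition frE p : 'rV[R]_4 := (enorm (preE p))^-1 *: preE p.

Definition frD p : 'rV[R]_4 := cross3 (N p) (frT p) (frE p).

Definition kappa p : R := dot (du frT p) (N p).
Definition sigma p : R := dot (du frE p) (frD p).
Definition tau p : R := dot (du frE p) (N p).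

Definition a34 p : R :=
  (kappa p)^-1 *
  ((kappa p * tau p * sigma p ^+ 2 - 4 * du kappa p * du tau p
      - kappa p * du (du tau) p) * kappa p
   - 2 * (du kappa p ^+ 2 + kappa p * du (du kappa) p) * tau p).

(* M v is the hypersurface carrying the curve u |-> Om (u, v) and nu v is its
   unit normal field. *)
Record has_ED2_frame (U : set (R * R)) (M : R -> set 'rV[R]_4)
    (nu : R -> 'rV[R]_4 -> 'rV[R]_4) : Prop := {
  ed2_unit_speed : forall p, U p -> enorm (du Om p) = 1 ;
  ed2_hypersurface : forall v, oriented_hypersurface (M v) (nu v) ;
  ed2_on_hypersurface : forall p, U p -> M p.2 (Om p) ;
  ed2_normal : forall p, U p -> N p = nu p.2 (Om p) ;
  ed2_dependent : forall p, U p -> ~~ free [:: N p; frT p; du (du Om) p] ;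
  ed2_preE_neq0 : forall p, U p -> preE p != 0
}.

End ED2Frame.

(* Main.v *)
(* Along a u-line Om_uu = kappa N, and preE = kappa (N_u + kappa T), whose norm
   is - kappa tau.  Hence the Gram determinant of Om_u, Om_uu, Om_uuu, that is
   |Om_v|^2, equals g^2 with g = kappa^2 tau; as Om_v is orthogonal to Om_u, the
   first fundamental form is du^2 + g^2 dv^2.  The symmetry of mixed partial
   derivatives then yields K = - g_uu / g, whereas the Leibniz rule gives
   kappa a34 = kappa^2 tau sigma^2 - g_uu. *)
Require Import Defs.
From HB Require Import structures.
From mathcomp Require Import all_boot all_order all_algebra.
From mathcomp Require Import all_classical all_reals all_analysis.
From mathcomp Require Import ring lra.
Import Order.TTheory GRing.Theory Num.Theory.
Import numFieldNormedType.Exports.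
Local Open Scope classical_set_scope.
Local Open Scope ring_scope.

Set Implicit Arguments.
Unset Strict Implicit.
Unset Printing Implicit Defensive.

(** * Directional derivatives: Leibniz and chain rules, mean values, symmetry of mixed
    derivatives *)

Section DirectionalDerivatives.
Context {R : realType} {V : normedModType R}.
Implicit Types (e p x : V) (U : set V).

(** The two difference quotients are the same function of [h]. This hands directional derivatives
    over to one-variable calculus. *)
Lemma is_derive_line {W : normedModType R} (f : V -> W) e x (s : R) :
  derivable f (s *: e + x) e ->
  is_derive s 1 (fun t => f (t *: e + x)) ('D_e f (s *: e + x)).
Proof.
move=> df.
have E : (fun h : R => h^-1 *: (((fun t => f (t *: e + x)) \o shift s) (h *: 1)
             - f (s *: e + x))) =
         (fun h : R => h^-1 *: ((f \o shift (s *: e + x)) (h *: e)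
             - f (s *: e + x))).
  by apply/funext => h /=; rewrite [h *: 1]mulr1 scalerDl addrA.
by apply: DeriveDef; rewrite /derivable /derive E.
Qed.

Lemma derive_eq_on {W : normedModType R} (f g : V -> W) e U p :
  open U -> U p -> (forall x, U x -> f x = g x) -> 'D_e f p = 'D_e g p.
Proof.
move=> Uo Up fg; apply: near_eq_derive; apply: filterS fg _.
exact: open_nbhs_nbhs.
Qed.

Lemma derivable_eq_on {W : normedModType R} (f g : V -> W) e U p :
  open U -> U p -> (forall x, U x -> f x = g x) ->
  derivable f p e -> derivable g p e.
Proof.
move=> Uo Up fg; apply: near_eq_derivable; apply: filterS fg _.
exact: open_nbhs_nbhs.
Qed.

Lemma derive_eq_cst_on {W : normedModType R} (f : V -> W) (c : W) e U p :
  open U -> U p -> (forall x, U x -> f x = c) -> 'D_e f p = 0.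
Proof.
move=> Uo Up fc; rewrite (derive_eq_on e Uo Up (g := cst c)) ?derive_cst //.
Qed.

Lemma is_derive_coord m n (f : V -> 'M[R]_(m, n)) e p i j :
  derivable f p e -> is_derive p e (fun x => f x i j) ('D_e f p i j).
Proof.
move=> df; rewrite (derive_mx df) [X in is_derive _ _ _ X]mxE.
by apply: derivableP; move/derivable_mxP : df; exact.
Qed.

Lemma is_derive_dot (f g : V -> 'rV[R]_4) e p :
  derivable f p e -> derivable g p e ->
  is_derive p e (fun x => dot (f x) (g x))
    (dot ('D_e f p) (g p) + dot (f p) ('D_e g p)).
Proof.
move=> df dg.
have dfg i := is_deriveM (is_derive_coord 0 i df) (is_derive_coord 0 i dg).
have := @is_derive_sum _ _ _ _ _ p e _ dfg.
rewrite /dot -big_split /= => D.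
rewrite (_ : (fun x => _) =
  \sum_(i < 4) ((fun x => f x 0 i) * (fun x => g x 0 i))).
  apply: (is_derive_eq D); apply: eq_bigr => i _.
  by rewrite addrC; congr (_ + _); exact: mulrC.
by apply/funext => x; rewrite fct_sumE.
Qed.

Lemma is_derive_scale m n (k : V -> R) (f : V -> 'M[R]_(m, n)) e p :
  derivable k p e -> derivable f p e ->
  is_derive p e (fun x => k x *: f x) ('D_e k p *: f p + k p *: 'D_e f p).
Proof.
move=> dk df.
have kfE i j : (fun x => (k x *: f x) i j) = k * (fun x => f x i j).
  by apply/funext => x; rewrite mxE.
have dkfi i j := is_deriveM (derivableP dk) (is_derive_coord i j df).
have dkf : derivable (fun x => k x *: f x) p e.
  by apply/derivable_mxP => i j; rewrite kfE; case: (dkfi i j).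
apply: DeriveDef => //; rewrite (derive_mx dkf); apply/matrixP => i j.
rewrite [LHS]mxE kfE; case: (dkfi i j) => _ ->; rewrite !mxE.
by rewrite addrC; congr (_ + _); exact: mulrC.
Qed.

(** Only derivability of [f] along [e] is assumed, so the chain rule is applied on the line
    [t *: e + p] and read back at [t = 0]. *)
Lemma is_derive_comp1 (h : R -> R) (f : V -> R) e p (dh : R) :
  derivable f p e -> is_derive (f p) 1 h dh ->
  is_derive p e (h \o f) (dh * 'D_e f p).
Proof.
move=> df Dh.
have E0 : 0 *: e + p = p by rewrite scale0r add0r.
have Df : is_derive (0 : R) (1 : R) (fun t : R => f (t *: e + p)) ('D_e f p).
  by rewrite -[in 'D_e f p]E0; apply: is_derive_line; rewrite E0.
have Dh0 : is_derive (f (0 *: e + p)) 1 h dh by rewrite E0.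
have [dhf <-] := @is_derive1_comp _ h (fun t => f (t *: e + p)) 0 _ _ Dh0 Df.
split; first exact/derivable1P.
rewrite /derive; set u := (X in X @ _); set v := (X in _ = lim (X @ _)).
suff -> : u = v by [].
by apply/funext => t; rewrite /u /v /= E0 addr0 [t *: 1]mulr1.
Qed.

(** The mean value theorem is applied to the difference of [g] along two parallel lines, so that a
    single [s] serves both. *)
Lemma MVT_line (g : V -> R) e x y (h : R) :
  0 <= h ->
  (forall s, 0 <= s <= h -> derivable g (s *: e + x) e /\
     derivable g (s *: e + y) e) ->
  exists2 s, 0 <= s <= h &
    g (h *: e + x) - g (h *: e + y) - (g x - g y) =
    ('D_e g (s *: e + x) - 'D_e g (s *: e + y)) * h.
Proof.
move=> h0 dg.
pose phi s : R := g (s *: e + x) - g (s *: e + y).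
have dphi s : s \in `[0, h] ->
    is_derive s 1 phi ('D_e g (s *: e + x) - 'D_e g (s *: e + y)).
  rewrite in_itv /= => /dg[gx gy].
  exact: is_deriveB (is_derive_line gx) (is_derive_line gy).
have dphi' s : s \in `]0, h[ -> is_derive s 1 phi _ :=
  fun sh => dphi s (subset_itv_oo_cc sh).
have phi_cont : {within `[0, h], continuous phi}.
  by apply: derivable_within_continuous => s sh; case: (dphi s sh).
have [s] := MVT_segment h0 dphi' phi_cont.
rewrite in_itv /= /phi => sh; rewrite subr0 !scale0r !add0r => E.
by exists s.
Qed.

(** Two mean value arguments: along [e1] for the difference between the lines through [h *: e2 + p]
    and [p], then along [e2] for ['D_e1 f] at the [s] so obtained. *)
Lemma second_difference_mean (f : V -> R) e1 e2 p (h : R) :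
  0 <= h ->
  (forall s t, 0 <= s <= h -> 0 <= t <= h ->
     derivable f (s *: e1 + (t *: e2 + p)) e1 /\
     derivable ('D_e1 f) (s *: e1 + (t *: e2 + p)) e2) ->
  exists s t, [/\ 0 <= s <= h, 0 <= t <= h &
    f (h *: e1 + (h *: e2 + p)) - f (h *: e1 + p) - (f (h *: e2 + p) - f p) =
    'D_e2 ('D_e1 f) (s *: e1 + (t *: e2 + p)) * h ^+ 2].
Proof.
move=> h0 df.
have hh : 0 <= h <= h by rewrite h0 /=.
have h00 : 0 <= (0 : R) <= h by rewrite lexx.
have [s sh|s sh ->] := @MVT_line f e1 (h *: e2 + p) p h h0.
  split; first exact: (df s h sh hh).1.
  by have := (df s 0 sh h00).1; rewrite scale0r add0r.
pose psi t := 'D_e1 f (s *: e1 + (t *: e2 + p)).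
have dpsi t : t \in `[0, h] ->
    is_derive t 1 psi ('D_e2 ('D_e1 f) (s *: e1 + (t *: e2 + p))).
  rewrite in_itv /= => th; have [_] := df s t sh th.
  rewrite addrCA => /is_derive_line.
  by congr (is_derive _ _ _ _); apply/funext => u; rewrite addrCA.
have dpsi' t : t \in `]0, h[ -> is_derive t 1 psi _ :=
  fun th => dpsi t (subset_itv_oo_cc th).
have psi_cont : {within `[0, h], continuous psi}.
  by apply: derivable_within_continuous => t th; case: (dpsi t th).
have [t] := MVT_segment h0 dpsi' psi_cont.
rewrite in_itv /= /psi => th; rewrite subr0 scale0r add0r => ->.
by exists s, t; rewrite -mulrA -expr2.
Qed.

(** Schwarz's theorem. The second difference is symmetric in [e1] and [e2], so the two mixed
    derivatives share a value at two points as close to [p] as desired; continuity at [p]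
    concludes. *)
Lemma derive_comm (f : V -> R) e1 e2 U p :
  open U -> U p ->
  (forall x, U x -> derivable f x e1) -> (forall x, U x -> derivable f x e2) ->
  (forall x, U x -> derivable ('D_e1 f) x e2) ->
  (forall x, U x -> derivable ('D_e2 f) x e1) ->
  {for p, continuous ('D_e2 ('D_e1 f))} ->
  {for p, continuous ('D_e1 ('D_e2 f))} ->
  'D_e2 ('D_e1 f) p = 'D_e1 ('D_e2 f) p.
Proof.
move=> Uo Up d1 d2 d12 d21 c12 c21.
apply/eqP; rewrite -subr_eq0 -normr_le0; apply/ler_addgt0Pl => /= eps eps0.
rewrite addr0.
have e20 : 0 < eps / 2 by rewrite divr_gt0.
move/cvgrPdist_le : c12 => /(_ _ e20) c12.
move/cvgrPdist_le : c21 => /(_ _ e20) c21.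
have /nbhs_ballP[r /= r0 rU] : \forall x \near p, [/\ U x,
    `|'D_e2 ('D_e1 f) p - 'D_e2 ('D_e1 f) x| <= eps / 2 &
    `|'D_e1 ('D_e2 f) p - 'D_e1 ('D_e2 f) x| <= eps / 2].
  have nU : nbhs p U by exact: open_nbhs_nbhs.
  apply: filterS (filterI nU (filterI c12 c21)) => x [Ux [d12x d21x]].
  split; [exact: Ux|exact: d12x|exact: d21x].
(* With this [h] the parallelogram of sides [h *: e1] and [h *: e2] at [p] stays within distance
   [r / 2]; the summand 1 keeps the denominator positive even for zero directions. *)
pose h := r / (`|e1| + `|e2| + 1) / 2.
have k0 : 0 < `|e1| + `|e2| + 1 by rewrite ltr_wpDl // addr_ge0.
have h0 : 0 < h by rewrite !divr_gt0.
have inr s t : 0 <= s <= h -> 0 <= t <= h -> ball p r (s *: e1 + (t *: e2 + p)).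
  move=> /andP[s0 sh] /andP[t0 th].
  rewrite -ball_normE /ball_ /= addrA opprD addrCA subrr addr0 normrN.
  apply: (le_lt_trans (ler_normD _ _)); rewrite !normrZ !ger0_norm //.
  have : s * `|e1| + t * `|e2| <= h * `|e1| + h * `|e2|.
    by apply: lerD; apply: ler_wpM2r.
  move/le_lt_trans; apply.
  have : h * (`|e1| + `|e2| + 1) = r / 2.
    by rewrite /h mulrAC divfK // gt_eqF.
  lra.
have [s [t [sh th E1]]] := @second_difference_mean f e1 e2 p h (ltW h0)
  (fun s t sh th => let: And3 Ux _ _ := rU _ (inr s t sh th) in
     conj (d1 _ Ux) (d12 _ Ux)).
have inr' s' t' : 0 <= s' <= h -> 0 <= t' <= h ->
    ball p r (s' *: e2 + (t' *: e1 + p)).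
  by move=> ? ?; rewrite addrCA; apply: inr.
have [s' [t' [sh' th' E2]]] := @second_difference_mean f e2 e1 p h (ltW h0)
  (fun s t sh th => let: And3 Ux _ _ := rU _ (inr' s t sh th) in
     conj (d2 _ Ux) (d21 _ Ux)).
(* Both sides times [h ^+ 2] are the same alternating sum of the four corner values. *)
have E : 'D_e2 ('D_e1 f) (s *: e1 + (t *: e2 + p)) =
         'D_e1 ('D_e2 f) (s' *: e2 + (t' *: e1 + p)).
  have h2 : h ^+ 2 != 0 by rewrite expf_neq0 // gt_eqF.
  apply: (mulIf h2); apply: (etrans (esym E1)); apply: (etrans _ E2).
  rewrite (addrCA (h *: e2)) !opprB.
  by rewrite addrACA [RHS]addrACA; congr (_ + _); exact: addrC.
have [_ A1 _] := rU _ (inr s t sh th).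
have [_ _ A2] := rU _ (inr' s' t' sh' th').
rewrite E in A1.
rewrite -(subrKA ('D_e1 ('D_e2 f) (s' *: e2 + (t' *: e1 + p)))).
apply: (le_trans (ler_normD _ _)); rewrite [leRHS]splitr.
by apply: lerD A1 _; rewrite distrC.
Qed.

Lemma is_derive_sqrt_comp (f : V -> R) e p :
  derivable f p e -> 0 < f p ->
  is_derive p e (fun x => Num.sqrt (f x)) ((2 * Num.sqrt (f p))^-1 * 'D_e f p).
Proof. by move=> df f0; apply: is_derive_comp1 df _; exact: is_derive1_sqrt. Qed.

End DirectionalDerivatives.

(** * Algebra of the inner product and of the ternary vector product *)

Section DotAlgebra.
Variable R : realType.
Implicit Types (x y z w : 'rV[R]_4) (a : R).

Lemma dotC x y : dot x y = dot y x.
Proof. by apply: eq_bigr => i _; rewrite mulrC. Qed.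

Lemma dotDl x y z : dot (x + y) z = dot x z + dot y z.
Proof.
by rewrite /dot -big_split; apply: eq_bigr => i _; rewrite mxE mulrDl.
Qed.

Lemma dotZl a x y : dot (a *: x) y = a * dot x y.
Proof.
by rewrite /dot mulr_sumr; apply: eq_bigr => i _; rewrite mxE mulrA.
Qed.

Lemma dotNl x y : dot (- x) y = - dot x y.
Proof. by rewrite -scaleN1r dotZl mulN1r. Qed.

Lemma dotDr x y z : dot x (y + z) = dot x y + dot x z.
Proof. by rewrite dotC dotDl !(dotC x). Qed.

Lemma dotZr a x y : dot x (a *: y) = a * dot x y.
Proof. by rewrite dotC dotZl dotC. Qed.

Lemma dotNr x y : dot x (- y) = - dot x y.
Proof. by rewrite dotC dotNl dotC. Qed.

Definition dotE := (dotDl, dotDr, dotZl, dotZr, dotNl, dotNr).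

(** By contraposition: pairing a vanishing combination with [t] and [n] leaves a multiple of
    [a - dot a n *: n], which is nonzero, so all coefficients vanish. *)
Lemma dependent_orthonormal n t (a : 'rV[R]_4) :
  dot n n = 1 -> dot n t = 0 -> dot t t = 1 -> dot t a = 0 ->
  ~~ free [:: n; t; a] -> a = dot a n *: n.
Proof.
move=> nn nt tt ta; apply: contraNeq => an.
apply/(@freeP _ _ 3 [tuple n; t; a]) => c.
rewrite !big_ord_recl big_ord0 /= addr0.
set c0 := c _; set c1 := c _; set c2 := c _ => c_eq0.
have cE x : c0 * dot n x + (c1 * dot t x + c2 * dot a x) = 0.
  by rewrite -!dotZl -!dotDl c_eq0 -(scale0r x) dotZl mul0r.
have c1_0 : c1 = 0.
  by have := cE t; rewrite nt tt [dot a t]dotC ta !mulr0 add0r addr0 mulr1.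
have c0E : c0 = - (c2 * dot a n).
  have := cE n; rewrite nn c1_0 mul0r add0r mulr1 => /eqP.
  by rewrite addr_eq0 => /eqP.
have c2_0 : c2 = 0.
  have /eqP : c2 *: (a - dot a n *: n) = 0.
    by rewrite -c_eq0 c1_0 c0E scale0r add0r scalerBr scaleNr scalerA addrC.
  by rewrite scaler_eq0 subr_eq0 (negPf an) orbF => /eqP.
have c0_0 : c0 = 0 by rewrite c0E c2_0 mul0r oppr0.
move=> i; case: (unliftP ord0 i) => [j ->|-> //].
by case: (unliftP ord0 j) => [l ->|-> //]; rewrite (ord1 l).
Qed.

Lemma dot_ge0 x : 0 <= dot x x.
Proof. by apply: sumr_ge0 => i _; rewrite -expr2 sqr_ge0. Qed.

Lemma dot_gt0 x : x != 0 -> 0 < dot x x.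
Proof.
move=> x0; rewrite lt_neqAle dot_ge0 andbT eq_sym; apply: contra_neq x0.
move=> /psumr_eq0P x0; apply/rowP => i; rewrite mxE.
apply/eqP; rewrite -[_ == 0]orbb -mulf_eq0; apply/eqP/x0 => // j _.
by rewrite -expr2 sqr_ge0.
Qed.

Lemma enorm_sqr x : enorm x ^+ 2 = dot x x.
Proof. by rewrite sqr_sqrtr // dot_ge0. Qed.

(** Indexing by natural numbers makes the indices left by expanding sums and minors reduce to
    numerals, so that [ring] recognizes equal coordinates. *)
Definition crd x (n : nat) : R := x 0 (inord n).

Lemma crdE x i : x 0 i = crd x i.
Proof. by rewrite /crd inord_val. Qed.

Lemma dot_crd x y : dot x y = crd x 0 * crd y 0 + crd x 1 * crd y 1
  + crd x 2 * crd y 2 + crd x 3 * crd y 3.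
Proof.
by rewrite /dot !big_ord_recl big_ord0 !crdE /= /bump /= addr0 !addrA.
Qed.

Lemma col_mx_row0 m n (a : 'rV[R]_n) (b : 'M[R]_(m, n)) j :
  (col_mx a b : 'M[R]_(m.+1, n)) 0 j = a 0 j.
Proof.
have -> : 0 = lshift m (0 : 'I_1) :> 'I_m.+1 by apply: val_inj.
exact: (@col_mxEu _ 1 m).
Qed.

Lemma col_mx_rowS m n (a : 'rV[R]_n) (b : 'M[R]_(m, n)) k j :
  (col_mx a b : 'M[R]_(m.+1, n)) (lift 0 k) j = b k j.
Proof.
have -> : lift 0 k = rshift 1 k :> 'I_m.+1 by apply: val_inj.
exact: (@col_mxEd _ 1 m).
Qed.

Lemma det_col_mx n (a : 'rV[R]_n.+1) (b : 'M[R]_(n, n.+1)) :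
  \det (col_mx a b : 'M[R]_n.+1) =
  \sum_j a 0 j * ((-1) ^+ j * \det (col' j b)).
Proof.
rewrite (expand_det_row _ 0); apply: eq_bigr => j _.
rewrite col_mx_row0 /cofactor; congr (_ * (_ * \det _)).
by apply/matrixP => k l; rewrite 2!mxE col_mx_rowS [RHS]mxE.
Qed.

Lemma col'_col_mx1 m n (a : 'rV[R]_n.+1) (b : 'M[R]_(m, n.+1)) j :
  col' j (col_mx a b : 'M[R]_(m.+1, n.+1)) = col_mx (col' j a) (col' j b).
Proof. exact: (@col'_col_mx _ 1 m). Qed.

(** Repeated Laplace expansion along the first row; [m2] and [m3] are the minors of the last two and
    last three rows. *)
Lemma det4_crd w x y z :
  let m2 (i j : nat) := crd y i * crd z j - crd y j * crd z i in
  let m3 (i j k : nat) :=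
    crd x i * m2 j k - crd x j * m2 i k + crd x k * m2 i j in
  det4 w x y z = crd w 0 * m3 1 2 3 - crd w 1 * m3 0 2 3
    + crd w 2 * m3 0 1 3 - crd w 3 * m3 0 1 2.
Proof.
move=> m2 m3; rewrite {}/m3 {}/m2 /det4 det_col_mx !big_ord_recl big_ord0.
rewrite !col'_col_mx1 !det_col_mx !big_ord_recl !big_ord0.
rewrite !col'_col_mx1 !det_col_mx !big_ord_recl !big_ord0.
rewrite !det_mx11 !mxE.
rewrite !crdE.
rewrite /= /bump /=.
rewrite /= ?(expr0, expr1, expr2, exprS).
ring.
Qed.

Lemma crd_cross3 x y z :
  let m2 (i j : nat) := crd y i * crd z j - crd y j * crd z i in
  let m3 (i j k : nat) :=
    crd x i * m2 j k - crd x j * m2 i k + crd x k * m2 i j in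
  [/\ crd (cross3 x y z) 0 = m3 1%N 2%N 3%N,
      crd (cross3 x y z) 1 = - m3 0%N 2%N 3%N,
      crd (cross3 x y z) 2 = m3 0%N 1%N 3%N
    & crd (cross3 x y z) 3 = - m3 0%N 1%N 2%N].
Proof.
move=> m2 m3.
have crd_delta (k l : nat) : (k < 4)%N -> (l < 4)%N ->
    crd (delta_mx 0 (inord k)) l = (l == k)%:R.
  by move=> k4 l4; rewrite /crd mxE eqxx -val_eqE /= !inordK.
split; rewrite /crd mxE det4_crd !crd_delta //= /m3 /m2; ring.
Qed.

(** The right-hand side is the Gram determinant of [x], [y], [z] expanded along its first row, a
    case of the Cauchy-Binet identity. *)
Lemma dot_cross3_Gram x y z :
  dot (cross3 x y z) (cross3 x y z) =
    dot x x * (dot y y * dot z z - dot y z ^+ 2)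
    - dot x y * (dot x y * dot z z - dot y z * dot x z)
    + dot x z * (dot x y * dot y z - dot y y * dot x z).
Proof.
have [c0 c1 c2 c3] := crd_cross3 x y z.
rewrite !dot_crd {}c0 {}c1 {}c2 {}c3; ring.
Qed.

Lemma dot_cross3_eq0 x y z : dot x (cross3 x y z) = 0.
Proof. by rewrite dot_cross3 det4_crd; ring. Qed.

(** The letters stand for [Om_u], [Om_v], [Om_uu], [Om_uv], [Om_vv], and [nor] for [normal_part].
    [A] is already normal and the tangential part of [X] is [(g1 / g) *: O], so the numerator is
    [dot A Y - dot X X + g1 * g1], that is [- (g * g2)]. *)
Lemma curvature_orthogonal_frame T O A X Y (g g1 g2 : R) : g != 0 ->
  dot T T = 1 -> dot T O = 0 -> dot O O = g ^+ 2 ->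
  dot T A = 0 -> dot A O = 0 -> dot T X = 0 -> dot X O = g * g1 ->
  dot A Y = dot X X - (g * g2 + g1 * g1) ->
  let d := dot T T * dot O O - dot T O ^+ 2 in
  let nor x := x - ((dot O O * dot x T - dot T O * dot x O) / d) *: T
                 - ((dot T T * dot x O - dot T O * dot x T) / d) *: O in
  (dot (nor A) (nor Y) - dot (nor X) (nor X)) / d = - g2 / g.
Proof.
move=> g0 TT TO OO TA AO TX XO AY; rewrite /= TT TO OO.
rewrite !dotE [dot A T]dotC [dot X T]dotC [dot Y T]dotC.
rewrite [dot O T]dotC [dot O X]dotC.
rewrite TT TO OO TA AO TX XO AY; field.
exact: g0.
Qed.

(** Here [n], [t], [n'] are [N], [T], [N_u], and [w] is the value that [preE] will have. The last
    equality holds because [w] is orthogonal to [t]. *)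
Lemma normal_derivative_frame (n t n' : 'rV[R]_4) (k : R)
    (w := k *: (n' + k *: t)) :
  dot n t = 0 -> dot t t = 1 -> dot n' n = 0 -> dot n' t = - k ->
  [/\ dot w n = 0, dot w w = k * k * (dot n' n' - k * k)
    & dot w w = k * dot w n'].
Proof.
move=> nt tt n'n n't; rewrite /w !dotE [dot t n]dotC [dot t n']dotC.
by rewrite nt tt n'n n't; split; ring.
Qed.

(** The arguments of [cross3] are [Om_u], [Om_uu], [Om_uuu]; [k'] disappears because its term is
    parallel to [n]. The result is [k * k] times the squared norm of [preE]. *)
Lemma dot_cross3_frame (n t n' : 'rV[R]_4) (k k' : R)
    (c := cross3 t (k *: n) (k' *: n + k *: n')) :
  dot n n = 1 -> dot n t = 0 -> dot t t = 1 -> dot n' n = 0 -> dot n' t = - k ->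
  dot c c = k * k * (k * k * (dot n' n' - k * k)).
Proof.
move=> nn nt tt n'n n't; rewrite /c dot_cross3_Gram !dotE.
rewrite [dot t n]dotC [dot t n']dotC [dot n n']dotC nn nt tt n'n n't; ring.
Qed.

End DotAlgebra.

(** * Iterated derivability in one fixed direction and its closure properties *)

Section IteratedDerivability.
Context {R : realType} {V : normedModType R} (U : set V) (e : V).
Hypothesis U_open : open U.

(** A one-directional weakening of [classC]: the curvature formula and [a34] differentiate [kappa]
    and [tau] along [u] only. *)
Fixpoint derivable_n {W : normedModType R} (k : nat) (f : V -> W) : Prop :=
  if k is k'.+1 then
    (forall x, U x -> derivable f x e) /\ derivable_n k' ('D_e f)
  else True.

Lemma derivable_n_eq_on (W : normedModType R) k (f g : V -> W) :
  (forall x, U x -> f x = g x) -> derivable_n k f -> derivable_n k g.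
Proof.
elim: k f g => //= k IH f g fg [df Df]; split.
  by move=> x Ux; apply: derivable_eq_on U_open Ux fg (df x Ux).
by apply: IH Df => x Ux; apply: derive_eq_on U_open Ux fg.
Qed.

Lemma derivable_nW (W : normedModType R) k (f : V -> W) :
  derivable_n k.+1 f -> derivable_n k f.
Proof.
elim: k f => // k IH f [df Df]; split; first exact: df.
exact: IH Df.
Qed.

Lemma derivable_nD k (f g : V -> R) :
  derivable_n k f -> derivable_n k g -> derivable_n k (fun x => f x + g x).
Proof.
elim: k f g => //= k IH f g [df Df] [dg Dg]; split.
  by move=> x Ux; apply: derivableD; [exact: df|exact: dg].
apply: derivable_n_eq_on (IH _ _ Df Dg) => x Ux.
by rewrite -deriveD; [|exact: df|exact: dg].
Qed.

Lemma derivable_nN k (f : V -> R) :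
  derivable_n k f -> derivable_n k (fun x => - f x).
Proof.
elim: k f => //= k IH f [df Df]; split.
  by move=> x Ux; apply: derivableN; exact: df.
apply: derivable_n_eq_on (IH _ Df) => x Ux.
by rewrite -deriveN; [|exact: df].
Qed.

(** Induction on the order: the Leibniz rule expresses the derivative as a sum of two values of [op]
    on functions of one order less. It covers both [*] and [dot]. *)
Lemma derivable_n_bilinear (W1 W2 : normedModType R) (op : W1 -> W2 -> R) :
  (forall f g x, derivable f x e -> derivable g x e ->
     is_derive x e (fun y => op (f y) (g y))
       (op ('D_e f x) (g x) + op (f x) ('D_e g x))) ->
  forall k (f : V -> W1) (g : V -> W2),
  derivable_n k f -> derivable_n k g -> derivable_n k (fun x => op (f x) (g x)).
Proof.
move=> leibniz; elim=> // k IH f g fk gk.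
have [df Df] := fk; have [dg Dg] := gk; split.
  by move=> x Ux; case: (leibniz f g x (df x Ux) (dg x Ux)).
have op_fg := derivable_nD (IH _ _ Df (derivable_nW gk))
  (IH _ _ (derivable_nW fk) Dg).
apply: derivable_n_eq_on op_fg => x Ux.
by case: (leibniz f g x (df x Ux) (dg x Ux)).
Qed.

Lemma derivable_nM k (f g : V -> R) :
  derivable_n k f -> derivable_n k g -> derivable_n k (fun x => f x * g x).
Proof.
apply: derivable_n_bilinear => {}f {}g x df dg.
apply: (is_derive_eq (is_deriveM (derivableP df) (derivableP dg))).
by rewrite addrC; congr (_ + _); exact: mulrC.
Qed.

Lemma derivable_n_dot k (f g : V -> 'rV[R]_4) :
  derivable_n k f -> derivable_n k g ->
  derivable_n k (fun x => dot (f x) (g x)).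
Proof. by apply: derivable_n_bilinear => {}f {}g x; exact: is_derive_dot. Qed.

(** The derivative is again a polynomial in [1 / f] and [f'], so the induction hypothesis applies to
    it. *)
Lemma derivable_nV k (f : V -> R) : (forall x, U x -> f x != 0) ->
  derivable_n k f -> derivable_n k (fun x => (f x)^-1).
Proof.
move=> f0; elim: k => // k IH fk; have [df Df] := fk; split.
  by move=> x Ux; apply: derivableV; [exact: f0|exact: df].
have Vk := IH (derivable_nW fk).
apply: derivable_n_eq_on (derivable_nN (derivable_nM (derivable_nM Vk Vk) Df)).
move=> x Ux; rewrite deriveV; [|exact: f0|exact: df].
by rewrite -exprVn expr2 scaleNr.
Qed.

(** Same scheme as for inverses, with [f' / (2 sqrt f)]; the factor 2 is written as a sum to fit
    [derivable_nD]. *)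
Lemma derivable_n_sqrt k (f : V -> R) : (forall x, U x -> 0 < f x) ->
  derivable_n k f -> derivable_n k (fun x => Num.sqrt (f x)).
Proof.
move=> f0; elim: k => // k IH fk; have [df Df] := fk; split.
  by move=> x Ux; case: (is_derive_sqrt_comp (df x Ux) (f0 x Ux)).
have Sk := IH (derivable_nW fk).
have S0 x : U x -> Num.sqrt (f x) + Num.sqrt (f x) != 0.
  by move=> Ux; rewrite gt_eqF // addr_gt0 // sqrtr_gt0 f0.
have DS := derivable_nM (derivable_nV S0 (derivable_nD Sk Sk)) Df.
apply: derivable_n_eq_on DS.
move=> x Ux; case: (is_derive_sqrt_comp (df x Ux) (f0 x Ux)) => _ ->.
by rewrite mulr_natl mulr2n.
Qed.

End IteratedDerivability.

(** * Partial derivatives in the parameter plane and their commutation for matrix-valued maps *)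

Section PlaneDerivatives.
Context {R : realType}.
Implicit Types (U : set (R * R)) (p : R * R).

Lemma classC_du (W : normedModType R) k U (f : R * R -> W) :
  classC k.+1 U f -> classC k U (du f).
Proof. by case=> _ []. Qed.

Lemma classC_dv (W : normedModType R) k U (f : R * R -> W) :
  classC k.+1 U f -> classC k U (dv f).
Proof. by case=> _ []. Qed.

Lemma classCW (W : normedModType R) k U (f : R * R -> W) :
  classC k.+1 U f -> classC k U f.
Proof.
elim: k f => [f [fc _]|k IH f [fc [fu fv uC vC]]]; first by split.
split; first exact: fc.
by split; [exact: fu|exact: fv|exact: IH uC|exact: IH vC].
Qed.

Lemma classC_derivable_u (W : normedModType R) k U (f : R * R -> W) p :
  classC k.+1 U f -> U p -> derivable f p ((1, 0) : R * R).
Proof. by case=> _ [df _ _ _]; exact: df. Qed.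

Lemma classC_derivable_v (W : normedModType R) k U (f : R * R -> W) p :
  classC k.+1 U f -> U p -> derivable f p ((0, 1) : R * R).
Proof. by case=> _ [_ df _ _]; exact: df. Qed.

Lemma classC_cont (W : normedModType R) k U (f : R * R -> W) p :
  classC k U f -> U p -> {for p, continuous f}.
Proof. by case: k => [|k] [fc _]; exact: fc. Qed.

Lemma classC_derivable_n (W : normedModType R) k U (f : R * R -> W) :
  classC k U f -> derivable_n U ((1, 0) : R * R) k f.
Proof.
elim: k f => // k IH f fC; split; last exact: IH (classC_du fC).
by move=> x; exact: classC_derivable_u fC.
Qed.

Lemma coord_derive_eq m n U (f : R * R -> 'M[R]_(m, n)) e :
  (forall x, U x -> derivable f x e) ->
  forall i j x, U x -> 'D_e (fun y => f y i j) x = 'D_e f x i j.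
Proof. by move=> df i j x Ux; case: (is_derive_coord i j (df x Ux)). Qed.

Lemma coord_derive2_eq m n U (f : R * R -> 'M[R]_(m, n)) e1 e2 :
  open U ->
  (forall x, U x -> derivable f x e1) ->
  (forall x, U x -> derivable ('D_e1 f) x e2) ->
  forall i j x, U x ->
  'D_e2 ('D_e1 (fun y => f y i j)) x = 'D_e2 ('D_e1 f) x i j.
Proof.
move=> U_open df d2f i j x Ux.
rewrite (derive_eq_on e2 U_open Ux (coord_derive_eq df i j)).
exact: (coord_derive_eq d2f).
Qed.

Lemma coord_derive2_cont m n U (f : R * R -> 'M[R]_(m.+1, n.+1)) e1 e2 p :
  open U -> U p ->
  (forall x, U x -> derivable f x e1) ->
  (forall x, U x -> derivable ('D_e1 f) x e2) ->
  {for p, continuous ('D_e2 ('D_e1 f))} ->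
  forall i j, {for p, continuous ('D_e2 ('D_e1 (fun y => f y i j)))}.
Proof.
move=> U_open Up df d2f cf i j.
have E := coord_derive2_eq U_open df d2f i j.
have cij : {for p, continuous (fun x => 'D_e2 ('D_e1 f) x i j)}.
  exact: (continuous_comp cf (@coord_continuous _ _ _ i j _)).
rewrite /prop_for /continuous_at E //; apply: cvg_trans cij.
apply: near_eq_cvg; apply: filterS (open_nbhs_nbhs (conj U_open Up)) => x Ux.
exact/esym/E.
Qed.

(** Schwarz's theorem is available for real functions, so it is applied entry by entry. *)
Lemma dv_du_comm m n U (f : R * R -> 'M[R]_(m.+1, n.+1)) p :
  open U -> U p -> classC 2 U f -> dv (du f) p = du (dv f) p.
Proof.
move=> U_open Up fC2.
have uC1 := classC_du fC2; have vC1 := classC_dv fC2.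
have fu x := @classC_derivable_u _ _ _ _ x fC2.
have fv x := @classC_derivable_v _ _ _ _ x fC2.
have fuv x := @classC_derivable_v _ _ _ _ x uC1.
have fvu x := @classC_derivable_u _ _ _ _ x vC1.
apply/matrixP => i j.
apply: (etrans (esym (coord_derive2_eq U_open fu fuv i j Up))).
apply: (etrans _ (coord_derive2_eq U_open fv fvu i j Up)).
apply: (derive_comm U_open Up) => [x Ux|x Ux|x Ux|x Ux||].
- by case: (is_derive_coord i j (fu x Ux)).
- by case: (is_derive_coord i j (fv x Ux)).
- apply: (derivable_eq_on U_open Ux) => [y Uy|].
    exact/esym/(coord_derive_eq fu).
  by case: (is_derive_coord i j (fuv x Ux)).
- apply: (derivable_eq_on U_open Ux) => [y Uy|].
    exact/esym/(coord_derive_eq fv).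
  by case: (is_derive_coord i j (fvu x Ux)).
- exact: (coord_derive2_cont U_open Up fu fuv (classC_cont (classC_dv uC1) Up)).
- exact: (coord_derive2_cont U_open Up fv fvu (classC_cont (classC_du vC1) Up)).
Qed.

End PlaneDerivatives.

(** * Gaussian curvature of a surface with metric [du^2 + g^2 dv^2] *)

Section Surfaces.
Context {R : realType} (U : set (R * R)).
Hypothesis U_open : open U.
Implicit Types (p : R * R) (f g : R * R -> 'rV[R]_4).

Lemma derive_dot_cst (c : R) f g e p : U p ->
  derivable f p e -> derivable g p e ->
  (forall x, U x -> dot (f x) (g x) = c) ->
  dot ('D_e f p) (g p) + dot (f p) ('D_e g p) = 0.
Proof.
move=> Up df dg fg; case: (is_derive_dot df dg) => _ <-.
exact: derive_eq_cst_on U_open Up fg.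
Qed.

(** Differentiating the three coefficients of the metric gives every inner product required by
    [curvature_orthogonal_frame]. The sign of [g] is left free, since [- g_uu / g] does not depend
    on it. *)
Lemma gaussian_curvature_orthogonal_geodesic (Om : R * R -> 'rV[R]_4)
    (g : R * R -> R) :
  classC 3 U Om -> derivable_n U ((1, 0) : R * R) 2 g ->
  (forall p, U p -> g p != 0) ->
  (forall p, U p -> fff_E Om p = 1) ->
  (forall p, U p -> fff_F Om p = 0) ->
  (forall p, U p -> fff_G Om p = g p ^+ 2) ->
  forall p, U p -> gaussian_curvature Om p = - du (du g) p / g p.
Proof.
move=> Om3 [dg [ddg _]] g0 E1 F0 G2.
have T2 := classC_du Om3; have O2 := classC_dv Om3.
have Tu p := @classC_derivable_u _ _ _ _ _ p T2.
have Tv p := @classC_derivable_v _ _ _ _ _ p T2.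
have Ou p := @classC_derivable_u _ _ _ _ _ p O2.
have Ov p := @classC_derivable_v _ _ _ _ _ p O2.
have TA p : U p -> dot (du Om p) (du (du Om) p) = 0.
  move=> Up; have := derive_dot_cst Up (Tu p Up) (Tu p Up) E1.
  by rewrite -/(du _) [dot (du (du _) p) _]dotC; lra.
have TX p : U p -> dot (du Om p) (dv (du Om) p) = 0.
  move=> Up; have := derive_dot_cst Up (Tv p Up) (Tv p Up) E1.
  by rewrite -/(dv _) [dot (dv (du _) p) _]dotC; lra.
have XE p (Up : U p) : dv (du Om) p = du (dv Om) p.
  exact: dv_du_comm U_open Up (classCW Om3).
have dgg p : U p -> is_derive p ((1, 0) : R * R) (fun x => g x * g x)
    (2 * (g p * du g p)).
  move=> Up; have dgp := derivableP (dg p Up).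
  by apply: (is_derive_eq (is_deriveM dgp dgp)); rewrite mulr_natl mulr2n.
have XO p : U p -> dot (dv (du Om) p) (dv Om p) = g p * du g p.
  move=> Up; have G2' x : U x -> dot (dv Om x) (dv Om x) = g x * g x.
    exact: G2.
  have := derive_eq_on ((1, 0) : R * R) U_open Up G2'.
  case: (is_derive_dot (Ou p Up) (Ou p Up)) => _ ->.
  case: (dgg p Up) => _ ->.
  rewrite -[derive _ _ _]/(du (dv Om) p) -(XE p Up) [dot (dv Om p) _]dotC.
  by lra.
have AO p : U p -> dot (du (du Om) p) (dv Om p) = 0.
  move=> Up.
  have H : dot (du (du Om) p) (dv Om p) + dot (du Om p) (dv (du Om) p) = 0.
    by rewrite (XE p Up); exact: derive_dot_cst Up (Tu p Up) (Ou p Up) F0.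
  by move: H; rewrite (TX p Up) addr0.
have TY p : U p -> dot (du Om p) (dv (dv Om) p) = - (g p * du g p).
  move=> Up.
  have H : dot (dv (du Om) p) (dv Om p) + dot (du Om p) (dv (dv Om) p) = 0.
    exact: derive_dot_cst Up (Tv p Up) (Ov p Up) F0.
  by move: H; rewrite (XO p Up) => /eqP; rewrite addrC addr_eq0 => /eqP.
move=> p Up.
have Y1 := classC_dv O2.
have XX : dot (dv (du Om) p) (dv (du Om) p)
    + dot (du Om p) (dv (dv (du Om)) p) = 0.
  exact: derive_dot_cst Up (Tv p Up) (classC_derivable_v (classC_dv T2) Up) TX.
(* Used with [x = |Om_uv|^2], [a = <Om_uu, Om_vv>] and [c = g g_uu + g_u^2]; [t] and [t'] are the
   products of [Om_u] with [Om_uvv] and [Om_vvu], which cancel. *)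
have aux (x t t' a c : R) : x + t = 0 -> a + t' = - c -> t' = t -> a = x - c.
  move=> /eqP; rewrite addr_eq0 => /eqP -> act <-.
  by rewrite -(addrK t' a) act addrC.
(* One exchange for [dv Om] at [p], then one for [Om] on all of [U], under the outer [dv]. *)
have duY : du (dv (dv Om)) p = dv (dv (du Om)) p.
  rewrite -(dv_du_comm U_open Up O2).
  by apply: (derive_eq_on _ U_open Up) => x Ux; rewrite XE.
have AY : dot (du (du Om) p) (dv (dv Om) p) + dot (du Om p) (du (dv (dv Om)) p)
    = - (g p * du (du g) p + du g p * du g p).
  case: (is_derive_dot (Tu p Up) (classC_derivable_u Y1 Up)) => _ <-.
  rewrite (derive_eq_on _ U_open Up TY).
  have dgdg := is_deriveM (derivableP (dg p Up)) (derivableP (ddg p Up)).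
  by case: (is_deriveN dgdg) => _ ->.
apply: (curvature_orthogonal_frame (g0 p Up) (E1 p Up) (F0 p Up) (G2 p Up)
  (TA p Up) (AO p Up) (TX p Up) (XO p Up)).
exact: aux XX AY (congr1 (dot (du Om p)) duY).
Qed.

End Surfaces.

(** The local equation [F] vanishes along the curve near [t], so the chain rule puts the velocity in
    the kernel of ['d F], to which [nu] is orthogonal. *)
Lemma dot_normal_velocity (R : realType) (M : set 'rV[R]_4)
    (nu : 'rV[R]_4 -> 'rV[R]_4) (c : R -> 'rV[R]_4) (t : R) :
  oriented_hypersurface M nu -> derivable c t 1 ->
  (\forall s \near t, M (c s)) -> dot (nu (c t)) ('D_1 c t) = 0.
Proof.
move=> [hM _ _] dc Mc.
have [W [F [[Wo Wct] dF _ MF]]] := hM _ (nbhs_singleton Mc); apply.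
have dct : differentiable c t by apply/derivable1_diffP.
have dFct : differentiable F (c t) by exact: (dF _ Wct).1.
rewrite (deriveE (1 : R) dct) -[LHS]/(('d F (c t) \o 'd c t) 1).
rewrite -(diff_comp dct dFct) -deriveE; last exact: differentiable_comp.
rewrite -(derive_cst (0 : R) t (1 : R)); apply: near_eq_derive.
have Wc : \forall s \near t, W (c s).
  apply: (differentiable_continuous dct); exact: open_nbhs_nbhs.
apply: filterS (filterI Mc Wc) => s [Ms Ws].
by have [/(_ Ms)] := MF _ Ws.
Qed.

(** The subtracted term is the second derivative of [k * k * t] in the unsimplified shape produced
    by the Leibniz rule. *)
Lemma a34_clear_denominator (F : fieldType) (k k1 k2 t t1 t2 s : F) : k != 0 ->
  k * (k^-1 * ((k * t * s ^+ 2 - 4 * k1 * t1 - k * t2) * k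
               - 2 * (k1 ^+ 2 + k * k2) * t))
  = k * (k * t * s ^+ 2)
    - (k * k * t2 + t1 * (k * k1 + k * k1)
       + (t * (k * k2 + k1 * k1 + (k * k2 + k1 * k1))
          + (k * k1 + k * k1) * t1)).
Proof. by move=> k0; rewrite mulVKf //; ring. Qed.

(** * Frame equations along the [u]-lines and the metric of the soliton surface *)

Section ED2Surface.
Context {R : realType} (U : set (R * R)) (Om N : R * R -> 'rV[R]_4)
  (M : R -> set 'rV[R]_4) (nu : R -> 'rV[R]_4 -> 'rV[R]_4).
Hypotheses (U_open : open U) (Om_smooth : classC 6 U Om)
  (N_smooth : classC 3 U N) (frame : has_ED2_frame Om N U M nu).
Implicit Type p : R * R.

Let k := kappa Om N.
Let e1 : R * R := (1, 0).

Let T_C5 := classC_du Om_smooth.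
Let A_C4 := classC_du T_C5.
Let Nu_C2 := classC_du N_smooth.
Let Tu p (Up : U p) : derivable (du Om) p e1 := classC_derivable_u T_C5 Up.
Let Nu p (Up : U p) : derivable N p e1 := classC_derivable_u N_smooth Up.
Let Nuu p (Up : U p) : derivable (du N) p e1 := classC_derivable_u Nu_C2 Up.

Lemma dot_TT p : U p -> dot (du Om p) (du Om p) = 1.
Proof. by move=> Up; rewrite -enorm_sqr (ed2_unit_speed frame) // expr1n. Qed.

Lemma dot_NN p : U p -> dot (N p) (N p) = 1.
Proof.
move=> Up; rewrite (ed2_normal frame Up) -enorm_sqr.
have [_ nu1 _] := ed2_hypersurface frame p.2.
by rewrite (nu1 _ (ed2_on_hypersurface frame Up)) expr1n.
Qed.

Lemma dot_NT p : U p -> dot (N p) (du Om p) = 0.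
Proof.
move=> Up; rewrite (ed2_normal frame Up).
pose c (s : R) : 'rV[R]_4 := Om (s *: e1 + p).
have E0 : 0 *: e1 + p = p by rewrite scale0r add0r.
have lineT : is_derive (0 : R) (1 : R) c (du Om p).
  rewrite -[X in du Om X]E0; apply: is_derive_line; rewrite E0.
  exact: classC_derivable_u Om_smooth Up.
have [dc <-] := lineT.
rewrite -[in Om p]E0; apply: (@dot_normal_velocity _ (M p.2)) => //.
  exact: ed2_hypersurface frame _.
(* The line keeps the second parameter equal to [p.2], so near [p] the curve stays on the single
   hypersurface [M p.2]. *)
have Uline : \forall s \near (0 : R), U (s *: e1 + p).
  have lc : {for (0 : R), continuous (fun s : R => s *: e1 + p)}.
    apply: differentiable_continuous.
    apply: differentiableD => //; exact: differentiableZl.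
  apply: lc; rewrite E0; exact: open_nbhs_nbhs.
apply: filterS Uline => s /(ed2_on_hypersurface frame).
by rewrite /= scaler0 add0r.
Qed.

Lemma dot_TA p : U p -> dot (du Om p) (du (du Om) p) = 0.
Proof.
move=> Up; have := derive_dot_cst U_open Up (Tu Up) (Tu Up) dot_TT.
by rewrite dotC -mulr2n => /eqP; rewrite mulrn_eq0 => /eqP.
Qed.

(** Unit speed makes [Om_uu] orthogonal to [T], so the assumed linear dependence leaves only its [N]
    component. *)
Lemma acceleration_normal p : U p -> du (du Om) p = k p *: N p.
Proof.
move=> Up; apply: (dependent_orthonormal (dot_NN Up) (dot_NT Up) (dot_TT Up)).
  exact: dot_TA.
exact: (ed2_dependent frame Up).
Qed.

Lemma dot_NuN p : U p -> dot (du N p) (N p) = 0.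
Proof.
move=> Up; have := derive_dot_cst U_open Up (Nu Up) (Nu Up) dot_NN.
by rewrite [X in _ + X]dotC -mulr2n => /eqP; rewrite mulrn_eq0 => /eqP.
Qed.

Lemma dot_NuT p : U p -> dot (du N p) (du Om p) = - k p.
Proof.
move=> Up.
have H : dot (du N p) (du Om p) + dot (N p) (du (du Om) p) = 0.
  exact: (derive_dot_cst U_open Up (Nu Up) (Tu Up) dot_NT).
by apply/eqP; rewrite -addr_eq0 /k /kappa [dot (du _ _) (N p)]dotC H.
Qed.

Lemma derivable_n_kappa : derivable_n U e1 3 k.
Proof.
exact: (derivable_n_dot U_open (derivable_nW (classC_derivable_n A_C4))
  (classC_derivable_n N_smooth)).
Qed.

Lemma jerkE p : U p -> du (du (du Om)) p = du k p *: N p + k p *: du N p.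
Proof.
move=> Up; rewrite /du -/(du Om) -/(du (du Om)).
rewrite (derive_eq_on e1 U_open Up acceleration_normal).
have [dk _] := derivable_n_kappa.
by case: (is_derive_scale (dk p Up) (Nu Up)).
Qed.

Lemma preE_normal_derivative p :
  U p -> preE Om N p = k p *: (du N p + k p *: du Om p).
Proof.
move=> Up; rewrite /preE /frT (jerkE Up) !dotE (dot_NN Up) (dot_NuN Up).
rewrite (dot_NT Up) (dot_NuT Up) !mulr0 add0r addr0 mulr1.
by rewrite (addrC (du k p *: N p)) addrK mulrN scaleNr opprK scalerDr scalerA.
Qed.

Lemma dot_preE p : U p ->
  [/\ dot (preE Om N p) (N p) = 0,
      dot (preE Om N p) (preE Om N p)
        = k p * k p * (dot (du N p) (du N p) - k p * k p)
    & dot (preE Om N p) (preE Om N p) = k p * dot (preE Om N p) (du N p)].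
Proof.
move=> Up; rewrite (preE_normal_derivative Up).
exact: normal_derivative_frame (dot_NT Up) (dot_TT Up) (dot_NuN Up)
  (dot_NuT Up).
Qed.

Lemma dot_preE_gt0 p : U p -> 0 < dot (preE Om N p) (preE Om N p).
Proof. by move=> Up; apply/dot_gt0/(ed2_preE_neq0 frame). Qed.

(** Differentiating [<E, N> = 0] gives [tau = - <E, N_u>]; then [kappa <preE, N_u> = |preE|^2] and
    [E] is the normalized [preE]. *)
Lemma kappa_tau p : U p -> k p * tau Om N p = - enorm (preE Om N p).
Proof.
move=> Up; have preE0 := dot_preE_gt0 Up.
have [dk _] := derivable_n_kappa.
have dpreE : derivable (preE Om N) p e1.
  apply: (derivable_eq_on U_open Up) => [x Ux|].
    exact/esym/preE_normal_derivative.
  have [dkT _] := is_derive_scale (dk p Up) (Tu Up).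
  by have [] := is_derive_scale (dk p Up) (derivableD (Nuu Up) dkT).
have [dpp _] := is_derive_dot dpreE dpreE.
have [dm _] := is_derive_sqrt_comp dpp preE0.
have m0 : enorm (preE Om N p) != 0 by rewrite gt_eqF // sqrtr_gt0.
have dV := @derivableV _ _ (fun x => enorm (preE Om N x)) p e1 m0 dm.
have [dE _] := is_derive_scale dV dpreE.
have EN x : U x -> dot (frE Om N x) (N x) = 0.
  by move=> Ux; have [EN0 _ _] := dot_preE Ux; rewrite dotZl EN0 mulr0.
have /eqP H : tau Om N p + dot (frE Om N p) (du N p) = 0.
  exact: (derive_dot_cst U_open Up dE (Nu Up) EN).
move: H; rewrite addr_eq0 => /eqP ->; rewrite dotZl mulrN mulrCA.
have [_ _ <-] := dot_preE Up.
by rewrite -enorm_sqr expr2 mulKf.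
Qed.

Hypothesis kappa_neq0 : forall p, U p -> k p != 0.

(** By [kappa_tau], [tau] is [- |preE| / kappa], and [|preE|] is the root of a positive polynomial
    in [kappa] and [|N_u|^2], which is derivable to order 2. *)
Lemma derivable_n_tau : derivable_n U e1 2 (tau Om N).
Proof.
have k2 := derivable_nW derivable_n_kappa.
have kk2 := derivable_nM U_open k2 k2.
have N2 := classC_derivable_n Nu_C2.
have m2 := derivable_nM U_open kk2 (derivable_nD U_open
  (derivable_n_dot U_open N2 N2) (derivable_nN U_open kk2)).
have m0 p : U p -> 0 < k p * k p * (dot (du N p) (du N p) - k p * k p).
  by move=> Up; have [_ <- _] := dot_preE Up; exact: dot_preE_gt0.
have tau2 := derivable_nN U_open (derivable_nM U_open
  (derivable_n_sqrt U_open m0 m2) (derivable_nV U_open kappa_neq0 k2)).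
apply: (derivable_n_eq_on U_open _ tau2) => p Up.
have [_ <- _] := dot_preE Up.
rewrite -mulNr -[Num.sqrt _]/(enorm _) -(kappa_tau Up) mulrAC.
by rewrite mulfV ?mul1r // kappa_neq0.
Qed.

(** A signed square root of [fff_G], with the sign of [tau]. *)
Definition warping p : R := k p * k p * tau Om N p.

Lemma derivable_n_warping : derivable_n U e1 2 warping.
Proof.
have k2 := derivable_nW derivable_n_kappa.
exact: (derivable_nM U_open (derivable_nM U_open k2 k2) derivable_n_tau).
Qed.

Hypothesis bdr : betchov_da_rios Om U.

Lemma fff_F_eq0 p : U p -> fff_F Om p = 0.
Proof. by move=> Up; rewrite /fff_F (bdr Up); exact: dot_cross3_eq0. Qed.

Lemma fff_G_eq p : U p -> fff_G Om p = warping p ^+ 2.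
Proof.
move=> Up; rewrite /fff_G (bdr Up) (jerkE Up) (acceleration_normal Up).
rewrite (dot_cross3_frame _ (dot_NN Up) (dot_NT Up) (dot_TT Up)
  (dot_NuN Up) (dot_NuT Up)).
have [_ <- _] := dot_preE Up.
have -> : warping p = - (k p * enorm (preE Om N p)).
  by rewrite -mulrN -(kappa_tau Up) /warping mulrA.
by rewrite sqrrN exprMn enorm_sqr expr2.
Qed.

Lemma kappa_a34 p : U p ->
  k p * a34 Om N p = k p * (k p * tau Om N p * sigma Om N p ^+ 2)
                     - du (du warping) p.
Proof.
move=> Up.
have [dk [ddk _]] := derivable_n_kappa.
have [dt [ddt _]] := derivable_n_tau.
have kP x Ux := derivableP (dk x Ux); have tP x Ux := derivableP (dt x Ux).
(* The first derivative keeps the exact shape given by the Leibniz rule, ready to be differentiated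
   by the same rules. *)
have dwarp x : U x -> du warping x =
    (k x * k x) * du (tau Om N) x + tau Om N x * (k x * du k x + k x * du k x).
  move=> Ux.
  by have [_ E] := is_deriveM (is_deriveM (kP x Ux) (kP x Ux)) (tP x Ux);
    exact: E.
have dP := derivableP (ddk p Up); have tPP := derivableP (ddt p Up).
have kdk := is_deriveM (kP p Up) dP.
have [_ ddwarp] := is_deriveD
  (is_deriveM (is_deriveM (kP p Up) (kP p Up)) tPP)
  (is_deriveM (tP p Up) (is_deriveD kdk kdk)).
rewrite (derive_eq_on e1 U_open Up dwarp : du (du warping) p = _) ddwarp.
exact: (a34_clear_denominator _ _ _ _ _ _ (kappa_neq0 Up)).
Qed.

End ED2Surface.
Unset Implicit Arguments.

Theorem theorem4 (R : realType) (U : set (R * R)) (Om N : R * R -> 'rV[R]_4)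
    (M : R -> set 'rV[R]_4) (nu : R -> 'rV[R]_4 -> 'rV[R]_4)
    (U_open : open U)
    (Om_smooth : classC 6 U Om) (N_smooth : classC 3 U N)
    (frame : has_ED2_frame Om N U M nu)
    (kappa_neq0 : forall p, U p -> kappa Om N p != 0)
    (tau_neq0 : forall p, U p -> tau Om N p != 0)
    (bdr : betchov_da_rios Om U) :
  flat_on Om U <->
  (forall p, U p ->
     a34 Om N p = kappa Om N p * tau Om N p * sigma Om N p ^+ 2).
Proof.
have Om3 : classC 3 U Om by do 3 apply: classCW.
have w0 p : U p -> warping Om N p != 0.
  move=> Up; have kp := kappa_neq0 p Up.
  exact: (mulf_neq0 (mulf_neq0 kp kp) (tau_neq0 p Up)).
have K p (Up : U p) : gaussian_curvature Om p
    = - du (du (warping Om N)) p / warping Om N p.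
  apply: (gaussian_curvature_orthogonal_geodesic U_open Om3 _ w0).
  - exact: (derivable_n_warping U_open Om_smooth N_smooth frame kappa_neq0).
  - exact: (dot_TT frame).
  - exact: (fff_F_eq0 bdr).
  - exact: (fff_G_eq U_open Om_smooth N_smooth frame bdr).
  - exact: Up.
have a34E p (Up : U p) :=
  kappa_a34 U_open Om_smooth N_smooth frame kappa_neq0 Up.
split=> [flat p Up|aE p Up].
  (* After multiplication by [kappa] the two sides differ by the second [u]-derivative of [warping],
     which vanishes with the curvature as [warping] is nonzero. *)
  apply: (mulfI (kappa_neq0 p Up)); rewrite (a34E p Up).
  move: (flat p Up); rewrite (K p Up) => /eqP.
  rewrite mulf_eq0 invr_eq0 (negPf (w0 p Up)) orbF oppr_eq0 => /eqP ->.
  by rewrite subr0.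
(* Conversely, the assumed equation cancels everything in [a34E] but that second derivative, the
   numerator of the curvature. *)
rewrite (K p Up); have := a34E p Up; rewrite (aE p Up) => /eqP.
rewrite eq_sym -subr_eq0 addrAC subrr add0r => /eqP ->.
by rewrite mul0r.
Qed.
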